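(* Let $G=(V_G,E_G)$ be a finite simple connected graph of order $n$ and let $p\in[0,1]$. Then $G$ is $p$TS-distance-balanced if and only if $G$ is self-$p$TS-median, i.e. $d_G^p(u)=\min_{v\in V_G} d_G^p(v)$ for every $u\in V_G$.
   Context: All graphs are finite, simple and connected; $d_G(u,v)$ is the geodesic distance. For $A\subseteq V_G$ and $u,v\in V_G$, $\rho_A(u,v)$ denotes the length of a shortest walk from $u$ to $v$ visiting every vertex of $A$ at least once (so $\rho_\emptyset=d_G$). For $A\subseteq V_G$ put $p_A=p^{|A|}(1-p)^{n-|A|}$ (with $0^0=1$). Define $d_G^p(u)=\frac1n\sum_{v\in V_G}\sum_{A\subseteq V_G}p_A\,\rho_A(u,v)$. For adjacent $u,v$ and $A\subseteq V_G$ let $W^A_{uv}=\{z\in V_G:\rho_A(z,u)<\rho_A(z,v)\}$ and $w^p_{uv}=\sum_{A\subseteq V_G}p_A|W^A_{uv}|$. $G$ is $p$TS-distance-balanced if $w^p_{uv}=w^p_{vu}$ for every pair of adjacent vertices $u,v$. *)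

(* Defs.v *)
From mathcomp Require Import all_boot all_order all_algebra.

Set Implicit Arguments.
Unset Strict Implicit.
Unset Printing Implicit Defensive.

Import Order.TTheory GRing.Theory Num.Theory.

Local Open Scope ring_scope.

Record cgraph (V : finType) := CGraph {
  adj : rel V;
  adj_sym : symmetric adj;
  adj_irr : irreflexive adj;
  adj_conn : forall u v, connect adj u v
}.

Section Rho.
Variables (V : finType) (G : cgraph V).
Implicit Types (A : {set V}) (u v : V) (k : nat).

(* The walk is u :: s, so its length (number of edges) is the size of s. *)
Definition is_walk A u v (s : seq V) : bool :=
  [&& path (adj G) u s, last u s == v & A \subset u :: s].

Definition has_walk A u v k : bool := [exists s : k.-tuple V, is_walk A u v s].

Lemma has_walkP A u v k :
  reflect (exists2 s, size s = k & is_walk A u v s) (has_walk A u v k).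
Proof.
apply: (iffP existsP) => [[s ws]|[s sk ws]]; first by exists s; rewrite ?size_tuple.
by move/eqP: sk => sk; exists (Tuple sk).
Qed.

Lemma has_walk_ex A u v : exists k, has_walk A u v k.
Proof.
suff [s ws] : exists s, is_walk A u v s.
  by exists (size s); apply/has_walkP; exists s.
suff [s [Ps Ls Ss]] : exists s,
    [/\ path (adj G) u s, last u s = v & {subset enum A <= u :: s}].
  exists s; rewrite /is_walk Ps Ls eqxx /=.
  by apply/subsetP => x xA; apply: Ss; rewrite mem_enum.
elim: (enum A) u => [|a r IH] u.
  by have /connectP[s Ps ->] := adj_conn G u v; exists s.
have /connectP[s1 P1 L1] := adj_conn G u a.
have [s2 [P2 L2 S2]] := IH a.
exists (s1 ++ s2); split; first by rewrite cat_path P1 -L1.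
- by rewrite last_cat -L1.
have a1 : a \in u :: s1 by rewrite L1 mem_last.
move=> x; rewrite -cat_cons mem_cat inE => /orP[/eqP->|/S2]; first by rewrite a1.
by rewrite inE => /orP[/eqP->|->]; rewrite ?a1 ?orbT.
Qed.

Definition rho A u v : nat := ex_minn (has_walk_ex A u v).

Definition W A u v : {set V} := [set z | (rho A z u < rho A z v)%N].

End Rho.

Section PTS.
Variables (R : realFieldType) (V : finType) (G : cgraph V) (p : R).

Definition pweight (A : {set V}) : R := p ^+ #|A| * (1 - p) ^+ (#|V| - #|A|).

Definition pdist (u : V) : R :=
  #|V|%:R^-1 * \sum_(v : V) \sum_(A : {set V}) pweight A * (rho G A u v)%:R.

Definition wp (u v : V) : R := \sum_(A : {set V}) pweight A * #|W G A u v|%:R.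

Definition pTS_distance_balanced : Prop :=
  forall u v : V, adj G u v -> wp u v = wp v u.

(* The seed pdist u is one of the values being minimised over, so the right-hand
   side is exactly the minimum of pdist over V. *)
Definition self_pTS_median : Prop :=
  forall u : V, pdist u = \big[Order.min/pdist u]_(v : V) pdist v.

End PTS.

(* Main.v *)
Require Import Defs.
From mathcomp Require Import all_boot all_order all_algebra.

Set Implicit Arguments.
Unset Strict Implicit.
Unset Printing Implicit Defensive.

Import Order.TTheory GRing.Theory Num.Theory.

Local Open Scope ring_scope.

(** Appending an edge [uv] to a walk shows that [rho A z u] and [rho A z v]
    differ by at most one, so their difference is the difference of the
    indicators of [W A u v] and [W A v u] at [z]. Summing over [z] and averaging
    over [A] gives [n (d^p v - d^p u) = w^p_uv - w^p_vu] on every edge. Hence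
    both conditions say that [d^p] is constant along edges, equivalently, by
    connectedness, constant. *)

Section RhoTheory.
Variables (V : finType) (G : cgraph V).
Implicit Types (A : {set V}) (u v z : V) (s : seq V).

Lemma rho_walk A u v : exists2 s, size s = rho G A u v & is_walk G A u v s.
Proof. by rewrite /rho; case: ex_minnP => k /has_walkP. Qed.

Lemma rho_le_size A u v s : is_walk G A u v s -> (rho G A u v <= size s)%N.
Proof.
move=> ws; rewrite /rho; case: ex_minnP => k _; apply.
by apply/has_walkP; exists s.
Qed.

Lemma is_walk_rev A u v s :
  is_walk G A u v s -> is_walk G A v u (rev (belast u s)).
Proof.
case/and3P=> Ps /eqP <- As; apply/and3P; split.
- by rewrite rev_path; under eq_path do rewrite adj_sym.
- by case: s {Ps As} => //= x s; rewrite rev_cons last_rcons.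
(* With its starting vertex restored, the new walk is the reversal of [u :: s], so it visits the
   same vertices. *)
- by rewrite -rev_rcons -lastI; apply: subset_trans As _;
    apply/subsetP=> x; rewrite mem_rev.
Qed.

Lemma is_walk_rcons A z u v s :
  adj G u v -> is_walk G A z u s -> is_walk G A z v (rcons s v).
Proof.
move=> uv /and3P[Ps /eqP Ls As]; apply/and3P; split.
- by rewrite rcons_path Ps Ls.
- by rewrite last_rcons.
- apply: subset_trans As _; apply/subsetP=> x.
  by rewrite -rcons_cons mem_rcons => xs; rewrite inE xs orbT.
Qed.

(** Walk reversal gives both inequalities. Symmetry is needed because [pdist] sums over the endpoint
    of the walk, whereas [W] collects starting points. *)
Lemma rhoC A u v : rho G A u v = rho G A v u.
Proof.
have le a b : (rho G A a b <= rho G A b a)%N.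
  have [s <- /is_walk_rev/rho_le_size] := rho_walk A b a.
  by rewrite size_rev size_belast.
by apply/eqP; rewrite eqn_leq !le.
Qed.

Lemma rho_adj A z u v : adj G u v -> (rho G A z v <= (rho G A z u).+1)%N.
Proof.
move=> uv; have [s <- /(is_walk_rcons uv)/rho_le_size] := rho_walk A z u.
by rewrite size_rcons.
Qed.

(** Stated additively because subtraction on [nat] truncates. *)
Lemma rho_edge_indicator A z u v : adj G u v ->
  (rho G A z v + (z \in W G A v u) = rho G A z u + (z \in W G A u v))%N.
Proof.
move=> uv; rewrite !inE.
have := rho_adj A z uv; have := rho_adj (u := v) (v := u) A z.
rewrite adj_sym => /(_ uv).
(* When the two values differ, the strict inequality and the one-step bound squeeze the gap to
   exactly one. *)
case: ltngtP => [lt_vu le_u _|lt_uv _ le_v|->] //.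
- by apply/eqP; rewrite addn0 addn1 eqn_leq le_u lt_vu.
- by apply/eqP; rewrite addn0 addn1 eqn_leq le_v.
Qed.

Lemma sum_rho_edge A u v : adj G u v ->
  (\sum_z rho G A z v + #|W G A v u| = \sum_z rho G A z u + #|W G A u v|)%N.
Proof.
move=> uv; rewrite -!sum1_card.
rewrite (big_mkcond (fun z => z \in W G A v u)).
rewrite (big_mkcond (fun z => z \in W G A u v)) -!big_split /=.
apply: eq_bigr => z _; have := rho_edge_indicator A z uv.
by case: (z \in _); case: (z \in _).
Qed.

Lemma const_adj_const (T : Type) (f : V -> T) :
  (forall u v, adj G u v -> f u = f v) -> forall u v, f u = f v.
Proof.
move=> fE u v; have /connectP[s Ps ->] := adj_conn G u v.
by elim: s u Ps => //= x s IH u /andP[/fE-> /IH].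
Qed.

End RhoTheory.

Section Median.
Variables (R : realFieldType) (V : finType) (G : cgraph V) (p : R).

Lemma pdist_edge u v : adj G u v ->
  pdist G p v - pdist G p u = #|V|%:R^-1 * (wp G p u v - wp G p v u).
Proof.
move=> uv; rewrite /pdist -mulrBr; congr (_ * _).
(* Summing over [A] outermost lets the edge identity apply to each [A] separately. *)
rewrite exchange_big [X in _ - X]exchange_big /=.
rewrite /wp -!sumrB; apply: eq_bigr => A _.
rewrite -!mulr_sumr -!mulrBr; congr (_ * _).
rewrite -!natr_sum.
under eq_bigr do rewrite rhoC.
under [X in _ - X%:R]eq_bigr do rewrite rhoC.
apply/eqP; rewrite subr_eq addrAC eq_sym subr_eq -!natrD.
by rewrite sum_rho_edge // addnC.
Qed.

Lemma balanced_pdist_const :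
  pTS_distance_balanced G p <-> forall u v, pdist G p u = pdist G p v.
Proof.
split=> [bal|cst u v uv].
  apply: (const_adj_const (G := G)) => u v uv; apply/esym/eqP.
  by rewrite -subr_eq0 pdist_edge // bal // subrr mulr0.
apply/eqP; rewrite -subr_eq0; have /eqP := pdist_edge uv.
rewrite (cst v u) subrr eq_sym mulf_eq0 invr_eq0 pnatr_eq0.
(* The vertex [u] makes [V] nonempty, so the factor [#|V|%:R^-1] is nonzero and can be cancelled. *)
by rewrite (gtn_eqF (_ : 0 < #|V|)%N) //; apply/card_gt0P; exists u.
Qed.

Lemma self_median_pdist_const :
  self_pTS_median G p <-> forall u v, pdist G p u = pdist G p v.
Proof.
split=> [med u v|cst u].
  (* By [med], the value at [a] is the minimum, hence at most the term at [b]; exchanging the roles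
     gives equality. *)
  have le a b : pdist G p a <= pdist G p b by rewrite med; apply: bigmin_le_cond.
  by apply/le_anti; rewrite !le.
(* Every term now equals the seed, so the running minimum never moves. *)
by under eq_bigr do rewrite (cst _ u); elim/big_rec: _ => // i x _ <-; rewrite minxx.
Qed.

End Median.

Theorem theorem2p8 (R : realFieldType) (V : finType) (G : cgraph V) (p : R)
    (hp : 0 <= p <= 1) :
  pTS_distance_balanced G p <-> self_pTS_median G p.
Proof.
exact: iff_trans (balanced_pdist_const G p)
  (iff_sym (self_median_pdist_const G p)).
Qed.
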